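(* Let $K$ be a field and let $I$ be a monomial ideal of $S=K[t_1,\ldots,t_s]$. Then $I^n=I^{(n)}$ for all $n\geq 1$ if and only if $I$ has no embedded primes and $\mathrm{Ass}(I^n)\subset\mathrm{Ass}(I)$ for all $n\geq 1$.
   Context: $\mathrm{Ass}(I)$ is the set of associated primes of $I$, i.e. primes of the form $(I\colon f)$, $f\in S$; an embedded prime is an associated prime properly containing another associated prime of $I$; $\mathrm{minAss}(I)$ is the set of inclusion-minimal elements of $\mathrm{Ass}(I)$. For $n\geq 1$, the $n$-th symbolic power is $I^{(n)}:=\bigcap_{\mathfrak{p}\in\mathrm{minAss}(I)}(I^nS_{\mathfrak{p}}\cap S)$ (in particular, $I^{(1)}$ need not equal $I$). *)

(* Defs.v *)
From mathcomp Require Import all_boot all_order all_algebra fraction.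
From mathcomp Require Import boolp classical_sets.
From mathcomp Require Import mpoly.

Set Implicit Arguments.
Unset Strict Implicit.
Unset Printing Implicit Defensive.

Import GRing.Theory.

Local Open Scope classical_set_scope.
Local Open Scope ring_scope.

(* Ideals are predicates [set R]; the structure [idealr] of ring_quotient is
   not used because it only covers decidable, proper ideals. *)

Definition ideal_span (R : comNzRingType) (A : set R) : set R :=
  [set f | exists (k : nat) (c a : 'I_k -> R),
     (forall i, A (a i)) /\ f = \sum_(i < k) c i * a i].

(* With n = 0 the only product is 1, so the 0-th power is the unit ideal. *)
Definition ideal_power (R : comNzRingType) (I : set R) (n : nat) : set R :=
  ideal_span [set \prod_(i < n) g i | g in [set g : 'I_n -> R | forall i, I (g i)]].

Definition colon (R : comNzRingType) (I : set R) (f : R) : set R :=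
  [set g | I (g * f)].

Definition is_ideal (R : comNzRingType) (I : set R) : Prop :=
  [/\ I 0, forall x y, I x -> I y -> I (x + y) & forall a x, I x -> I (a * x)].

Definition is_prime_ideal (R : comNzRingType) (P : set R) : Prop :=
  [/\ is_ideal P, ~ P 1 & forall x y, P (x * y) -> P x \/ P y].

Definition Ass (R : comNzRingType) (I : set R) : set (set R) :=
  [set P | is_prime_ideal P /\ exists f : R, P = colon I f].

Definition minAss (R : comNzRingType) (I : set R) : set (set R) :=
  [set P | Ass I P /\ forall Q, Ass I Q -> Q `<=` P -> Q = P].

Definition embedded_prime (R : comNzRingType) (I : set R) (P : set R) : Prop :=
  Ass I P /\ exists Q, Ass I Q /\ Q `<` P.

(* The localization of a domain R at a prime ideal P, as a subring of the
   field of fractions of R. *)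
Definition localization (R : idomainType) (P : set R) : set {fraction R} :=
  [set x | exists a b : R, ~ P b /\ x = tofrac a / tofrac b].

(* The ideal J R_P of R_P generated by J. *)
Definition ext_ideal (R : idomainType) (P J : set R) : set {fraction R} :=
  [set x | exists (k : nat) (c : 'I_k -> {fraction R}) (a : 'I_k -> R),
     [/\ forall i, localization P (c i), forall i, J (a i) &
         x = \sum_(i < k) c i * tofrac (a i)]].

Definition symbolic_power (R : idomainType) (I : set R) (n : nat) : set R :=
  \bigcap_(P in minAss I) (@tofrac R @^-1` ext_ideal P (ideal_power I n)).

Definition is_monomial_ideal (K : fieldType) (s : nat)
    (I : set {mpoly K[s]}) : Prop :=
  exists A : set 'X_{1..s}, I = ideal_span [set 'X_[K, m] | m in A].

(* Main.v *)
Require Import Defs.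
From mathcomp Require Import all_boot all_order all_algebra fraction.
From mathcomp Require Import boolp classical_sets.
From mathcomp Require Import mpoly.

(** The equivalence is a fact about ideals of a Noetherian domain
    ([power_eq_symbolic_iff]); a polynomial ring over a field is one by the
    Hilbert basis theorem, proved here with leading monomials and Dickson's lemma
    ([mpoly_noetherian]).

    The working tool is the existence of associated primes ([Ass_avoiding]): if
    no element of a multiplicative set [W] multiplies [f] into an ideal [J], then
    some associated prime of [J] contains the colon ideal [(J : f)] and avoids
    [W]. It is used for two choices of [W]: with [W = {1}] it
    puts [(J : f)] inside an associated prime as soon as [f] is not in [J]; with
    [W] the complement of a prime [P] containing [J], and [f = 1], it puts an
    associated prime of [J] inside [P]. Moreover [f] lies in the contraction of
    [J S_P] exactly when [(J : f)] is not contained in [P] ([ext_idealP]).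

    Suppose that the ordinary and symbolic powers agree, and let [P = (I^n : f)]
    be associated to [I^n]. Then [f] is outside [I^n = I^(n)], so [(I^n : f) = P]
    is contained in some minimal [p] in [Ass I]. As [P] contains [I^n], hence [I],
    it contains an associated prime of [I], which must be [p] by minimality, so
    that [P = p]. Thus [Ass (I^n)] is contained in [minAss I]; for [n = 1] this
    says that [I] has no embedded primes.

    Conversely, let [f] be in [I^(n)] but not in [I^n]. Then [(I^n : f)] lies in
    some [P] in [Ass (I^n)]; by hypothesis [P] is in [Ass I], and it is minimal
    there. But then [f] lies in the contraction of [I^n S_P], which means that
    [(I^n : f)] is not contained in [P], a contradiction. *)

Set Implicit Arguments.
Unset Strict Implicit.
Unset Printing Implicit Defensive.

Import Order.TTheory GRing.Theory.

Local Open Scope classical_set_scope.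
Local Open Scope ring_scope.

(** * Dickson's lemma *)

Lemma nat_fun_argmin_from (u : nat -> nat) (n : nat) :
  exists m, (n <= m)%N /\ forall j, (m <= j)%N -> (u m <= u j)%N.
Proof.
have ex_val : exists v, `[< exists2 m, (n <= m)%N & u m = v >].
  by exists (u n); apply/asboolP; exists n.
case: (ex_minnP ex_val) => _ /asboolP[m le_nm <-] min_um.
exists m; split=> // j le_mj; apply: min_um; apply/asboolP.
by exists j => //; apply: leq_trans le_mj.
Qed.

Lemma nondecreasing_subseq (u : nat -> nat) :
  exists phi : nat -> nat, {homo phi : i j / (i < j)%N} /\
    {homo u \o phi : i j / (i <= j)%N}.
Proof.
have [g gP] := choice (nat_fun_argmin_from u).
pose fix phi k := if k is k'.+1 then g (phi k').+1 else g 0.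
have phiS k : (phi k < phi k.+1)%N by have [] := gP (phi k).+1.
have phi_lt : {homo phi : i j / (i < j)%N} by exact: (homo_ltn ltn_trans phiS).
have phi_min k j : (phi k <= j)%N -> (u (phi k) <= u j)%N.
  by case: k => [|k] /=; [apply: (gP 0%N).2 | apply: (gP _).2].
exists phi; split=> // i j le_ij; apply: phi_min.
by move: le_ij; rewrite leq_eqVlt => /predU1P[->//|/phi_lt/ltnW].
Qed.

(** The coordinates are treated one at a time: a further extraction keeps the
    monotonicity of the coordinates already dealt with. *)
Lemma nondecreasing_subseq_all (T : eqType) (r : seq T) (u : nat -> T -> nat) :
  exists phi : nat -> nat, {homo phi : i j / (i < j)%N} /\
    forall t, t \in r -> {homo (fun k => u (phi k) t) : i j / (i <= j)%N}.
Proof.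
elim: r => [|t r [phi [phi_lt phi_le]]].
  by exists id; split=> [i j|t]; rewrite ?in_nil.
have [psi [psi_lt psi_le]] := nondecreasing_subseq (fun k => u (phi k) t).
exists (phi \o psi); split=> [i j lt_ij | t']; first exact/phi_lt/psi_lt.
rewrite inE => /predU1P[-> // | t'r] i j le_ij /=; apply: (phi_le t' t'r).
by move: le_ij; rewrite leq_eqVlt => /predU1P[->//|/psi_lt/ltnW].
Qed.

Lemma dickson (s : nat) (u : nat -> 'X_{1..s}) :
  exists i j, (i < j)%N /\ (u i <= u j)%MM.
Proof.
have [phi [phi_lt phi_le]] :=
  nondecreasing_subseq_all (enum 'I_s) (fun k (t : 'I_s) => u k t).
exists (phi 0), (phi 1); split; first exact: phi_lt.
by apply/mnm_lepP => t; apply: (phi_le t) => //; rewrite mem_enum.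
Qed.

(** * Noetherian rings and the Hilbert basis theorem *)

Definition noetherian (R : comNzRingType) : Prop :=
  forall F : set (set R), F !=set0 -> F `<=` @is_ideal R ->
  exists J, F J /\ forall J', F J' -> J `<=` J' -> J' = J.

Lemma idealB (R : comNzRingType) (J : set R) (x y : R) :
  is_ideal J -> J x -> J y -> J (x - y).
Proof. by case=> _ JD JM Jx Jy; rewrite -mulN1r; apply/JD/JM. Qed.

Lemma noetherian_no_chain (R : comNzRingType) :
  (forall J : nat -> set R, (forall k, is_ideal (J k)) ->
     (forall k, J k `<` J k.+1) -> False) -> noetherian R.
Proof.
move=> no_chain F [J0 FJ0] Fid; apply: contrapT => no_max.
have next (J : {J | F J}) : exists J' : {J | F J}, sval J `<` sval J'.
  apply: contrapT => nextN; apply: no_max; exists (sval J); split.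
    exact: (svalP J).
  move=> J' FJ' JJ'; apply: contrapT => neqJ'; apply: nextN.
  exists (exist _ J' FJ'); split=> //= J'J.
  by apply: neqJ'; apply/seteqP.
have [g gP] := choice next.
pose J k := iter k g (exist _ J0 FJ0).
apply: (no_chain (fun k => sval (J k))) => k; last exact: gP.
exact/Fid/(svalP (J k)).
Qed.

Lemma mleadB_lt (K : fieldType) (s : nat) (p q : {mpoly K[s]}) :
  mlead p = mlead q -> mleadc p = mleadc q -> p - q != 0 ->
  (mlead (p - q) < mlead p)%O.
Proof.
move=> eq_lead eq_lc nz; rewrite lt_neqAle; apply/andP; split; last first.
  by apply: le_trans (mleadB_le _ _) _; rewrite -eq_lead joinxx.
apply: contra nz => /eqP eq_m.
by rewrite -mleadc_eq0 eq_m mcoeffB eq_lc {1}eq_lead subrr.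
Qed.

(** In a strictly ascending chain of ideals, pick in each [J k.+1] an element
    outside [J k] with the smallest possible leading monomial. Dickson's lemma
    gives [i < j] such that the [i]-th leading monomial divides the [j]-th;
    subtracting a multiple of the [i]-th element, which lies in [J j], from the
    [j]-th one lowers its leading monomial without entering [J j]. *)
Theorem mpoly_noetherian (K : fieldType) (s : nat) : noetherian {mpoly K[s]}.
Proof.
apply: noetherian_no_chain => J Jid Jlt.
have ex_min k : exists f, (J k.+1 f /\ ~ J k f) /\
    forall g, J k.+1 g -> ~ J k g -> ~ (mlead g < mlead f)%O.
  have [_ /existsNP[f /not_implyP[Jf nJf]]] := Jlt k.
  elim/mleadrect: f Jf nJf => f IH Jf nJf.
  have [[g [Jg nJg lt_gf]]|minf] :=
    EM (exists g, [/\ J k.+1 g, ~ J k g & (mlead g < mlead f)%O]).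
    exact: IH lt_gf Jg nJg.
  by exists f; split=> // g Jg nJg lt_gf; apply: minf; exists g.
have [f fP] := choice ex_min.
have J_homo i j : (i <= j)%N -> J i `<=` J j.
  elim: j => [|j IHj]; first by rewrite leqn0 => /eqP->.
  rewrite leq_eqVlt => /predU1P[->//|/IHj Jij].
  exact: subset_trans Jij (Jlt j).1.
have f_neq0 k : f k != 0.
  apply/eqP => fk0; have [[_ nJf] _] := fP k.
  by apply: nJf; rewrite fk0; have [] := Jid k.
have [i [j [lt_ij le_m]]] := dickson (fun k => mlead (f k)).
have [[Jfj nJfj] fj_min] := fP j.
pose m := (mlead (f j) - mlead (f i))%MM.
pose c := mleadc (f j) / mleadc (f i).
have lci_neq0 : mleadc (f i) != 0 by rewrite mleadc_eq0.
have c_neq0 : c != 0 by rewrite mulf_neq0 ?invr_eq0 ?mleadc_eq0.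
have X_neq0 : 'X_[m] != 0 :> {mpoly K[s]}.
  by rewrite -mleadc_eq0 mleadXm mcoeffX eqxx oner_eq0.
have lead_Xf : mlead ('X_[m] * f i) = (m + mlead (f i))%MM.
  by rewrite mleadM ?mleadXm.
pose h := c *: ('X_[m] * f i).
have lead_h : mlead h = mlead (f j).
  by rewrite mleadZ // lead_Xf submK.
have lc_h : mleadc h = mleadc (f j).
  rewrite mleadcZE lead_Xf -{1}(mleadXm K m) mleadcM mleadXm mcoeffX eqxx mul1r.
  by rewrite divfK.
have Jh : J j h.
  rewrite /h scalerAl; have [_ _ JM] := Jid j; apply: JM.
  by apply: (J_homo i.+1) => //; have [[]] := fP i.
have nJ : ~ J j (f j - h).
  move=> Jd; apply: nJfj; rewrite -[f j](subrK h).
  by have [_ JD _] := Jid j; apply: JD.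
apply: (fj_min (f j - h)) => //.
  by apply: idealB => //; apply: (Jlt j).1.
apply: mleadB_lt => //; apply/eqP => d0; apply: nJ.
by rewrite d0; have [] := Jid j.
Qed.

(** * Spans, powers and colons of ideals *)

Section Ideals.
Context (R : comNzRingType).
Implicit Types (I J P : set R).

Lemma ideal_sum J (T : Type) (r : seq T) (F : T -> R) :
  is_ideal J -> (forall i, J (F i)) -> J (\sum_(i <- r) F i).
Proof. by case=> J0 JD _ JF; apply: (big_ind J). Qed.

Lemma ideal_span_ideal (A : set R) : is_ideal (ideal_span A).
Proof.
split=> [|x y [k [c [a [Aa ->]]]] [l [d [b [Ab ->]]]] | z x [k [c [a [Aa ->]]]]].
- by exists 0, (fun=> 0), (fun=> 0); split=> [[]//|]; rewrite big_ord0.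
- pose glue (u : 'I_k -> R) (v : 'I_l -> R) (i : 'I_(k + l)) :=
    match split i with inl i1 => u i1 | inr i2 => v i2 end.
  have glue_l u v i : glue u v (lshift l i) = u i.
    by rewrite /glue (unsplitK (inl i)).
  have glue_r u v i : glue u v (rshift k i) = v i.
    by rewrite /glue (unsplitK (inr i)).
  exists (k + l), (glue c d), (glue a b); split.
    by move=> i; rewrite /glue; case: split.
  rewrite big_split_ord /=; congr (_ + _); apply: eq_bigr => i _.
    by rewrite !glue_l.
  by rewrite !glue_r.
- exists k, (fun i => z * c i), a; split=> //.
  by rewrite mulr_sumr; apply: eq_bigr => i _; rewrite mulrA.
Qed.

Lemma ideal_span_sub (A : set R) J : is_ideal J -> A `<=` J -> ideal_span A `<=` J.
Proof.
move=> Jid AJ _ [k [c [a [Aa ->]]]]; apply: ideal_sum => // i.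
by have [_ _ JM] := Jid; apply/JM/AJ.
Qed.

Lemma sub_ideal_span (A : set R) : A `<=` ideal_span A.
Proof.
move=> x Ax; exists 1, (fun=> 1), (fun=> x); split=> //.
by rewrite big_ord1 mul1r.
Qed.

Lemma ideal_power_sub I n : is_ideal I -> (1 <= n)%N -> ideal_power I n `<=` I.
Proof.
move=> Iid; case: n => // n _; apply: ideal_span_sub => // _ [g gI <-].
by rewrite big_ord_recl mulrC; have [_ _ IM] := Iid; apply: IM.
Qed.

Lemma ideal_powerX I n x : I x -> ideal_power I n (x ^+ n).
Proof.
move=> Ix; apply: sub_ideal_span; exists (fun=> x) => //.
by rewrite prodr_const card_ord.
Qed.

Lemma ideal_power1 I : is_ideal I -> ideal_power I 1 = I.
Proof.
move=> Iid; apply/seteqP; split; first exact: ideal_power_sub.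
by move=> x Ix; rewrite -[x]expr1; apply: ideal_powerX.
Qed.

Lemma prime_sub_power P I n : is_prime_ideal P -> ideal_power I n `<=` P -> I `<=` P.
Proof.
move=> [_ P1 PM] InP x Ix; have /InP := ideal_powerX n Ix.
by elim: n {InP} => [|n IHn]; rewrite ?expr0 // exprS => /PM[|/IHn].
Qed.

Lemma colon_ideal J f : is_ideal J -> is_ideal (colon J f).
Proof.
move=> [J0 JD JM]; split=> [|x y|a x]; rewrite /colon /= ?mul0r ?mulrDl -?mulrA //.
  exact: JD.
exact: JM.
Qed.

Lemma colon_mul J f g : is_ideal J -> colon J f `<=` colon J (g * f).
Proof. by case=> _ _ JM x Jxf; rewrite /colon /= mulrCA; apply: JM. Qed.

Lemma Ass_sub J P : is_ideal J -> Ass J P -> J `<=` P.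
Proof.
by move=> [_ _ JM] [_ [f ->]] x Jx; rewrite /colon /= mulrC; apply: JM.
Qed.

(** * Existence of associated primes *)

(** Among the ideals [(J : g f)] that avoid [W], a maximal one [(J : h)] is
    prime. Let [a b] be in [(J : h)] with [a] outside. If [(J : a h)] avoids [W],
    it equals [(J : h)] and contains [b]. Otherwise it contains some [c] in [W];
    since [W] is multiplicative, [(J : c h)] still avoids [W], so it equals
    [(J : h)]; but it contains [a]. *)
Theorem Ass_avoiding (W : set R) J f : noetherian R -> is_ideal J ->
  W 1 -> (forall x y, W x -> W y -> W (x * y)) ->
  (forall x, W x -> ~ J (x * f)) ->
  exists Q, [/\ Ass J Q, colon J f `<=` Q & forall x, W x -> ~ Q x].
Proof.
move=> noeth Jid W1 WM Wf.
pose avoids h := forall x, W x -> ~ colon J h x.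
pose F := [set Q | exists g, avoids (g * f) /\ Q = colon J (g * f)].
have [||Q [[g [av_h ->]] maxQ]] := noeth F.
- by exists (colon J f), 1; rewrite mul1r.
- by move=> _ [g [_ ->]]; apply: colon_ideal.
set h := g * f in av_h maxQ.
have maxh a : avoids (a * h) -> colon J (a * h) = colon J h.
  move=> av; apply: maxQ; last exact: colon_mul.
  by exists (a * g); rewrite -mulrA.
exists (colon J h); split=> //; last exact: colon_mul.
split; last by exists h.
split; [exact: colon_ideal | exact: av_h | move=> a b Jabh].
have [Jah|nJah] := EM (colon J h a); [by left | right].
have [av_ah|] := EM (avoids (a * h)).
  by rewrite -(maxh a) // /colon /= mulrCA mulrA.
move=> /existsNP[c /not_implyP[Wc /contrapT Jcah]].
case: nJah; rewrite -(maxh c); first by rewrite /colon /= mulrCA.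
by move=> x Wx; rewrite /colon /= mulrA; apply: av_h; apply: WM.
Qed.

Corollary colon_sub_Ass J f : noetherian R -> is_ideal J -> ~ J f ->
  exists2 Q, Ass J Q & colon J f `<=` Q.
Proof.
move=> noeth Jid nJf.
have [||x ->|Q [AQ fQ _]] := @Ass_avoiding [set 1] J f noeth Jid.
- by [].
- by move=> _ _ -> ->; rewrite /= mulr1.
- by rewrite mul1r.
by exists Q.
Qed.

Corollary prime_contains_Ass J P : noetherian R -> is_ideal J ->
  is_prime_ideal P -> J `<=` P -> exists2 Q, Ass J Q & Q `<=` P.
Proof.
move=> noeth Jid [_ P1 PM] JP.
have [||x nPx|Q [AQ _ QP]] := @Ass_avoiding (~` P) J 1 noeth Jid.
- exact: P1.
- by move=> x y nPx nPy /PM[].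
- by rewrite mulr1 => /JP.
by exists Q => // x Qx; apply: contrapT => nPx; apply: (QP x).
Qed.

End Ideals.

(** * Contraction of localized ideals *)

(** Clearing denominators: the elements of [J R_P] are the fractions [g / b] with
    [g] in [J] and [b] outside [P]. *)
Lemma ext_ideal_denom (R : idomainType) (P J : set R) (x : {fraction R}) :
  is_prime_ideal P -> is_ideal J -> ext_ideal P J x ->
  exists b g, [/\ ~ P b, J g & x * tofrac b = tofrac g].
Proof.
move=> [[P0 _ _] P1 PM] [J0 JD JM] [k [c [a [cP aJ ->]]]].
pose D x := exists b g, [/\ ~ P b, J g & x * tofrac b = tofrac g].
apply: (big_ind D) => [|y z [b [g [nPb Jg eg]]] [b' [g' [nPb' Jg' eg']]] | i _].
- by exists 1, 0; split=> //; rewrite tofrac0 mul0r.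
- exists (b * b'), (b' * g + b * g'); split; first by case/PM.
    by apply: JD; apply: JM.
  rewrite tofracD !tofracM -eg -eg' mulrDl; congr (_ + _).
    by rewrite [RHS]mulrC mulrA.
  by rewrite mulrCA.
have [u [v [nPv ->]]] := cP i.
exists v, (u * a i); split=> //; first exact: JM.
rewrite mulrAC divfK ?tofracM // tofrac_eq0.
by apply/eqP => v0; apply: nPv; rewrite v0.
Qed.

Lemma ext_idealP (R : idomainType) (P J : set R) (f : R) :
  is_prime_ideal P -> is_ideal J ->
  ext_ideal P J (tofrac f) <-> exists2 b, ~ P b & colon J f b.
Proof.
move=> Pp Jid; split=> [/(ext_ideal_denom Pp Jid)[b [g [nPb Jg]]] | [b nPb Jbf]].
  rewrite -tofracM => /eqP; rewrite tofrac_eq => /eqP eg.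
  by exists b => //; rewrite /colon /= mulrC eg.
exists 1, (fun=> tofrac 1 / tofrac b), (fun=> b * f); split=> //.
  by move=> _; exists 1, b.
rewrite big_ord1 tofracM tofrac1 mul1r mulKf // tofrac_eq0.
by apply/eqP => b0; apply: nPb; rewrite b0; have [[]] := Pp.
Qed.

(** * Comparison of ordinary and symbolic powers *)

Section NoetherianDomain.
Context (R : idomainType) (noeth : noetherian R).
Implicit Types I P : set R.

Let power_ideal I n : is_ideal (ideal_power I n).
Proof. exact: ideal_span_ideal. Qed.

Lemma ideal_power_sub_symbolic I n : ideal_power I n `<=` symbolic_power I n.
Proof.
move=> f If P [[Pp _] _]; apply/(ext_idealP _ Pp) => //.
by exists 1; [have [] := Pp | rewrite /colon /= mul1r].
Qed.

Lemma Ass_power_sub_minAss I n : is_ideal I -> (1 <= n)%N ->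
  ideal_power I n = symbolic_power I n -> Ass (ideal_power I n) `<=` minAss I.
Proof.
move=> Iid n1 eqI P AP; have [Pp [f eP]] := AP.
have nIf : ~ ideal_power I n f.
  by move=> If; have [_ P1 _] := Pp; apply: P1; rewrite eP /colon /= mul1r.
have /existsNP[p /not_implyP[minp nfp]] : ~ symbolic_power I n f by rewrite -eqI.
have [[pp _] p_min] := minp.
have Pp_sub : P `<=` p.
  rewrite eP => b Jb; apply: contrapT => npb; apply: nfp.
  by apply/(ext_idealP _ pp) => //; exists b.
have IP : I `<=` P by apply: (prime_sub_power (n := n)) => //; apply: Ass_sub.
have [Q AQ QP] := prime_contains_Ass noeth Iid Pp IP.
suff -> : P = p by [].
apply/seteqP; split=> //.
by rewrite -(p_min Q AQ (subset_trans QP Pp_sub)).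
Qed.

Theorem power_eq_symbolic_iff I : is_ideal I ->
  (forall n : nat, (1 <= n)%N -> ideal_power I n = symbolic_power I n) <->
  (~ (exists P, embedded_prime I P)) /\
  (forall n : nat, (1 <= n)%N -> Ass (ideal_power I n) `<=` Ass I).
Proof.
move=> Iid; split=> [eqI | [no_emb AssI] n n1].
  have Amin n (n1 : (1 <= n)%N) := Ass_power_sub_minAss Iid n1 (eqI n n1).
  split=> [[P [AP [Q [AQ [QP nPQ]]]]] | n n1 P /(Amin n n1)[]//].
  have := Amin 1 isT P; rewrite ideal_power1 // => /(_ AP)[_ /(_ Q AQ QP) eQP].
  by apply: nPQ; rewrite eQP.
apply/seteqP; split; first exact: ideal_power_sub_symbolic.
move=> f fsym; apply: contrapT => nIf.
have [P AP fP] := colon_sub_Ass noeth (power_ideal I n) nIf.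
have AIP := AssI n n1 P AP.
have minP : minAss I P.
  split=> // Q AQ QP; apply: contrapT => neqQP; apply: no_emb; exists P; split=> //.
  by exists Q; split=> //; split=> // PQ; apply: neqQP; apply/seteqP.
have [b nPb Jb] := (ext_idealP f AP.1 (power_ideal I n)).1 (fsym P minP).
exact/nPb/fP.
Qed.

End NoetherianDomain.

Theorem proposition5p4 (K : fieldType) (s : nat) (I : set {mpoly K[s]})
    (monI : is_monomial_ideal I) :
  (forall n : nat, (1 <= n)%N -> ideal_power I n = symbolic_power I n) <->
  (~ (exists P : set {mpoly K[s]}, embedded_prime I P)) /\
  (forall n : nat, (1 <= n)%N -> Ass (ideal_power I n) `<=` Ass I).
Proof.
apply: power_eq_symbolic_iff; first exact: mpoly_noetherian.
by have [A ->] := monI; apply: ideal_span_ideal.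
Qed.
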